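(* Let $\mathbf{k}$ be a field, $V$ a $\mathbf{k}$-vector space, and $T(V)=\bigoplus_{n\ge1}V^{\otimes n}$ the nonunitary tensor algebra. The free dendriform trialgebra over $V$ is a canonical sub-dendriform trialgebra of the free nonunitary Rota-Baxter algebra $\mathrm{Sha}_1(T(V))$ of weight one over the algebra $T(V)$; that is, the unique morphism of dendriform trialgebras from the free dendriform trialgebra over $V$ to $\mathrm{Sha}_1(T(V))$ extending the natural map $V\to T(V)\to\mathrm{Sha}_1(T(V))$ is injective.
   Context: A nonunitary $\mathbf{k}$-algebra is an associative $\mathbf{k}$-algebra not required to have a unit. A nonunitary Rota-Baxter algebra of weight one is a pair $(A,R)$ with $A$ a nonunitary $\mathbf{k}$-algebra and $R:A\to A$ a $\mathbf{k}$-linear map such that $R(x)R(y)=R(R(x)y+xR(y)+xy)$ for all $x,y\in A$. A homomorphism $(A,R)\to(A',R')$ is a nonunitary algebra homomorphism $g$ with $g\circ R=R'\circ g$. A dendriform trialgebra is a $\mathbf{k}$-module $T$ with bilinear operations $\prec,\succ,\cdot$ such that, with $\star=\prec+\succ+\,\cdot$, for all $x,y,z\in T$: $(x\prec y)\prec z=x\prec(y\star z)$, $(x\succ y)\prec z=x\succ(y\prec z)$, $(x\star y)\succ z=x\succ(y\succ z)$, $(x\succ y)\cdot z=x\succ(y\cdot z)$, $(x\prec y)\cdot z=x\cdot(y\succ z)$, $(x\cdot y)\prec z=x\cdot(y\prec z)$, $(x\cdot y)\cdot z=x\cdot(y\cdot z)$. Morphisms are linear maps preserving the three operations. A Rota-Baxter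 algebra $(A,R)$ of weight one is regarded as a dendriform trialgebra with $x\prec_R y=xR(y)$, $x\succ_R y=R(x)y$, $x\cdot_R y=xy$. The free dendriform trialgebra over $V$ is a dendriform trialgebra with a linear map from $V$ through which every linear map from $V$ to a dendriform trialgebra factors by a unique morphism of dendriform trialgebras. The free nonunitary Rota-Baxter algebra of weight one over a nonunitary algebra $B$ is a nonunitary Rota-Baxter algebra $(\mathrm{Sha}_1(B),R_B)$ of weight one with a nonunitary algebra homomorphism $j_B:B\to\mathrm{Sha}_1(B)$ such that for every nonunitary Rota-Baxter algebra $A$ of weight one and nonunitary algebra homomorphism $f:B\to A$ there is a unique Rota-Baxter homomorphism $\bar f:\mathrm{Sha}_1(B)\to A$ with $\bar f\circ j_B=f$. In the claim $B=T(V)$. *)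

(* Defs.v *)
From HB Require Import structures.
From mathcomp Require Import all_boot all_algebra.

Set Implicit Arguments.
Unset Strict Implicit.
Unset Printing Implicit Defensive.

Import GRing.Theory.
Local Open Scope ring_scope.

Definition bilinear_op (K : fieldType) (U : lmodType K) (op : U -> U -> U) :=
  (forall y, linear (op^~ y)) /\ (forall x, linear (op x)).

HB.mixin Record isNonunitaryAlgebra (K : fieldType) A
    of GRing.Lmodule K A := {
  nmul : A -> A -> A;
  nmul_bilinear : bilinear_op nmul;
  nmulA : associative nmul
}.

#[short(type="nuAlgType")]
HB.structure Definition NonunitaryAlgebra (K : fieldType) :=
  { A of isNonunitaryAlgebra K A & GRing.Lmodule K A }.

HB.mixin Record hasRotaBaxterOperator (K : fieldType) A
    of NonunitaryAlgebra K A := {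
  rbop : A -> A;
  rbop_linear : linear rbop;
  rbopM : forall x y : A,
    nmul (rbop x) (rbop y) =
    rbop (nmul (rbop x) y + nmul x (rbop y) + nmul x y)
}.

#[short(type="rbAlgType")]
HB.structure Definition RotaBaxterAlgebra (K : fieldType) :=
  { A of hasRotaBaxterOperator K A & NonunitaryAlgebra K A }.

Definition tri_star (U : nmodType) (prec succ dot : U -> U -> U) (x y : U) :=
  prec x y + succ x y + dot x y.

HB.mixin Record isDendriformTrialgebra (K : fieldType) T
    of GRing.Lmodule K T := {
  tprec : T -> T -> T;
  tsucc : T -> T -> T;
  tdot : T -> T -> T;
  tprec_bilinear : bilinear_op tprec;
  tsucc_bilinear : bilinear_op tsucc;
  tdot_bilinear : bilinear_op tdot;
  tprec_prec : forall x y z,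
    tprec (tprec x y) z = tprec x (tri_star tprec tsucc tdot y z);
  tprec_succ : forall x y z,
    tprec (tsucc x y) z = tsucc x (tprec y z);
  tsucc_star : forall x y z,
    tsucc (tri_star tprec tsucc tdot x y) z = tsucc x (tsucc y z);
  tdot_succ : forall x y z, tdot (tsucc x y) z = tsucc x (tdot y z);
  tdot_prec : forall x y z, tdot (tprec x y) z = tdot x (tsucc y z);
  tprec_dot : forall x y z, tprec (tdot x y) z = tdot x (tprec y z);
  tdot_dot : forall x y z, tdot (tdot x y) z = tdot x (tdot y z)
}.

#[short(type="dendTriType")]
HB.structure Definition DendriformTrialgebra (K : fieldType) :=
  { T of isDendriformTrialgebra K T & GRing.Lmodule K T }.

Definition is_nualg_morphism (K : fieldType) (A B : nuAlgType K)
    (f : A -> B) : Prop :=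
  linear f /\ {morph f : x y / nmul x y}.

Definition is_rb_morphism (K : fieldType) (A B : rbAlgType K)
    (f : A -> B) : Prop :=
  is_nualg_morphism f /\ {morph f : x / rbop x}.

Definition is_dend_morphism (K : fieldType) (S T : dendTriType K)
    (f : S -> T) : Prop :=
  [/\ linear f, {morph f : x y / tprec x y},
      {morph f : x y / tsucc x y} & {morph f : x y / tdot x y}].

(* An alias of the carrier, so that the trialgebra structure induced by the
   Rota-Baxter operator does not become canonical on the algebra itself. *)
Definition rb_dend (K : fieldType) (A : rbAlgType K) : Type := A.

Section RotaBaxterToDendriform.
Variables (K : fieldType) (A : rbAlgType K).

HB.instance Definition _ := GRing.Lmodule.on (rb_dend A).

Definition rb_prec (x y : rb_dend A) : rb_dend A :=
  nmul (x : A) (rbop (y : A)).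
Definition rb_succ (x y : rb_dend A) : rb_dend A :=
  nmul (rbop (x : A)) (y : A).
Definition rb_dot (x y : rb_dend A) : rb_dend A := nmul (x : A) (y : A).

Fact rb_dot_bilinear : bilinear_op rb_dot.
Proof. exact: (@nmul_bilinear K A). Qed.

Fact rb_prec_bilinear : bilinear_op rb_prec.
Proof.
have [linl linr] := @nmul_bilinear K A.
split=> [y | x a y z]; first exact: linl.
by rewrite /rb_prec rbop_linear; apply: linr.
Qed.

Fact rb_succ_bilinear : bilinear_op rb_succ.
Proof.
have [linl linr] := @nmul_bilinear K A.
split=> [y a x z | x]; last exact: linr.
by rewrite /rb_succ rbop_linear; apply: linl.
Qed.

Fact rb_starE (x y : A) :
  rbop (tri_star rb_prec rb_succ rb_dot x y : A) = nmul (rbop x) (rbop y).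
Proof.
rewrite rbopM /tri_star /rb_prec /rb_succ /rb_dot.
by congr (rbop (_ + _)); rewrite addrC.
Qed.

Fact rb_prec_prec x y z :
  rb_prec (rb_prec x y) z = rb_prec x (tri_star rb_prec rb_succ rb_dot y z).
Proof. by rewrite {3}/rb_prec rb_starE /rb_prec nmulA. Qed.

Fact rb_prec_succ x y z :
  rb_prec (rb_succ x y) z = rb_succ x (rb_prec y z).
Proof. by rewrite /rb_prec /rb_succ nmulA. Qed.

Fact rb_succ_star x y z :
  rb_succ (tri_star rb_prec rb_succ rb_dot x y) z = rb_succ x (rb_succ y z).
Proof. by rewrite {1}/rb_succ rb_starE /rb_succ nmulA. Qed.

Fact rb_dot_succ x y z : rb_dot (rb_succ x y) z = rb_succ x (rb_dot y z).
Proof. by rewrite /rb_dot /rb_succ nmulA. Qed.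

Fact rb_dot_prec x y z : rb_dot (rb_prec x y) z = rb_dot x (rb_succ y z).
Proof. by rewrite /rb_dot /rb_succ /rb_prec nmulA. Qed.

Fact rb_prec_dot x y z : rb_prec (rb_dot x y) z = rb_dot x (rb_prec y z).
Proof. by rewrite /rb_dot /rb_prec nmulA. Qed.

Fact rb_dot_dot x y z : rb_dot (rb_dot x y) z = rb_dot x (rb_dot y z).
Proof. by rewrite /rb_dot nmulA. Qed.

HB.instance Definition _ :=
  isDendriformTrialgebra.Build K (rb_dend A)
    rb_prec_bilinear rb_succ_bilinear rb_dot_bilinear
    rb_prec_prec rb_prec_succ rb_succ_star rb_dot_succ rb_dot_prec
    rb_prec_dot rb_dot_dot.

End RotaBaxterToDendriform.

Definition is_multilinear (K : fieldType) (V W : lmodType K) (n : nat)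
    (f : n.-tuple V -> W) : Prop :=
  forall (u : n.-tuple V) (i : 'I_n),
    linear (fun v => f [tuple if j == i then v else tnth u j | j < n]).

Definition is_tensor_power (K : fieldType) (V P : lmodType K) (n : nat)
    (tau : n.-tuple V -> P) : Prop :=
  is_multilinear tau /\
  forall (W : lmodType K) (f : n.-tuple V -> W), is_multilinear f ->
    exists g : P -> W,
      [/\ linear g, g \o tau =1 f
        & forall g' : P -> W, linear g' -> g' \o tau =1 f -> g' =1 g].

Definition is_direct_sum (K : fieldType) (P : nat -> lmodType K)
    (B : lmodType K) (inj : forall n, P n -> B) : Prop :=
  (forall n, linear (inj n)) /\
  forall (W : lmodType K) (f : forall n, P n -> W), (forall n, linear (f n)) ->
    exists g : B -> W,
      [/\ linear g, forall n, g \o inj n =1 f n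
        & forall g' : B -> W, linear g' ->
            (forall n, g' \o inj n =1 f n) -> g' =1 g].

(* The nonunitary tensor algebra, with the sum starting in degree one:
   [P n] is the tensor power of exponent [n.+1].  The concatenation in the last
   clause is well typed because [m.+1 + n.+1] converts to [(m + n.+1).+1]. *)
Definition is_nonunitary_tensor_algebra (K : fieldType) (V : lmodType K)
    (P : nat -> lmodType K) (tau : forall n, n.+1.-tuple V -> P n)
    (B : nuAlgType K) (inj : forall n, P n -> B) : Prop :=
  [/\ forall n, is_tensor_power (@tau n),
      is_direct_sum inj
    & forall m n (u : m.+1.-tuple V) (v : n.+1.-tuple V),
        nmul (inj m (tau m u)) (inj n (tau n v)) =
        inj (m + n.+1)%N (tau (m + n.+1)%N [tuple of u ++ v])].

Definition tensor_incl (K : fieldType) (V : lmodType K)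
    (P : nat -> lmodType K) (tau : forall n, n.+1.-tuple V -> P n)
    (B : nuAlgType K) (inj : forall n, P n -> B) (v : V) : B :=
  inj 0%N (tau 0%N [tuple v]).

Definition is_free_rb (K : fieldType) (B : nuAlgType K) (S : rbAlgType K)
    (j : B -> S) : Prop :=
  is_nualg_morphism j /\
  forall (A : rbAlgType K) (f : B -> A), is_nualg_morphism f ->
    exists g : S -> A,
      [/\ is_rb_morphism g, g \o j =1 f
        & forall g' : S -> A, is_rb_morphism g' -> g' \o j =1 f -> g' =1 g].

Definition is_free_dend (K : fieldType) (V : lmodType K) (D : dendTriType K)
    (i : V -> D) : Prop :=
  linear i /\
  forall (T : dendTriType K) (f : V -> T), linear f ->
    exists g : D -> T,
      [/\ is_dend_morphism g, g \o i =1 f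
        & forall g' : D -> T, is_dend_morphism g' -> g' \o i =1 f -> g' =1 g].

(* Main.v *)
From Stdlib Require Import IndefiniteDescription.
From HB Require Import structures.
Require Import Defs.
From mathcomp Require Import all_boot all_algebra.

(** Every dendriform trialgebra [D], free or not, embeds into a Rota-Baxter
    algebra of weight one, and this alone forces the canonical map from the
    free trialgebra to [Sha] to be injective.

    The axioms of a trialgebra say that [D] with its total product
    [star = tprec + tsucc + tdot] is an associative algebra ([dend_starA]),
    that [D] with [tdot] is another one, and that the first acts on the second
    on both sides, through [tsucc] on the left and [tprec] on the right,
    compatibly with [tdot].  So [D * D] carries the associative product
      [(a, b) (c, d) = (star a c, tsucc a d + tprec b c + tdot b d)].
    On it [R (a, b) = (b - a, 0)], which copies the second summand onto the
    first and is minus the identity on the first, is a Rota-Baxter operator of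
    weight one, and [b |-> (0, b)] preserves the three operations: for
    instance [(0, b) R (0, d) = (0, b) (d, 0) = (0, tprec b d)].  This
    embedding is due to Gubarev and Kolesnikov.

    Let [e : D -> D * D] be this embedding for the free trialgebra [D] over
    [V].  The tensor algebra is the free nonunitary algebra
    ([tensor_algebra_extension]), so [e] restricted to [V] extends to an
    algebra morphism on it, hence to a Rota-Baxter morphism [G] on [Sha].  The
    composite of [G] with the canonical map [D -> Sha] agrees with [e] on [V],
    so it equals [e] since [D] is free; as [e] is injective, so is
    [D -> Sha]. *)

Set Implicit Arguments.
Unset Strict Implicit.
Unset Printing Implicit Defensive.

Import GRing.Theory.
Local Open Scope ring_scope.

(** * Linear and bilinear maps as bare functions *)

Section BareLinear.
Variables (K : fieldType) (U W X : lmodType K).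

Lemma bare_linearD (f : U -> W) : linear f -> {morph f : x y / x + y}.
Proof. by move=> lf x y; have := lf 1 x y; rewrite !scale1r. Qed.

Lemma bare_linear0 (f : U -> W) : linear f -> f 0 = 0.
Proof.
by move=> lf; apply: (@addIr _ (f 0)); rewrite -bare_linearD // !add0r.
Qed.

Lemma bare_linearN (f : U -> W) : linear f -> {morph f : x / - x}.
Proof.
move=> lf x; apply: (@addIr _ (f x)).
by rewrite -bare_linearD // !addNr bare_linear0.
Qed.

Lemma comp_linear (g : W -> X) (f : U -> W) :
  linear g -> linear f -> linear (g \o f).
Proof. by move=> lg lf a x y; rewrite /= lf lg. Qed.

End BareLinear.

Section BareBilinear.
Variables (K : fieldType) (U : lmodType K) (op : U -> U -> U).
Hypothesis bil : bilinear_op op.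

Lemma bilinearDl x y z : op (x + y) z = op x z + op y z.
Proof. exact: (bare_linearD (bil.1 z)). Qed.

Lemma bilinearDr x y z : op x (y + z) = op x y + op x z.
Proof. exact: (bare_linearD (bil.2 x)). Qed.

Lemma bilinear0l x : op 0 x = 0.
Proof. exact: (bare_linear0 (bil.1 x)). Qed.

Lemma bilinear0r x : op x 0 = 0.
Proof. exact: (bare_linear0 (bil.2 x)). Qed.

Lemma bilinearNl x y : op (- x) y = - op x y.
Proof. exact: (bare_linearN (bil.1 y)). Qed.

Lemma bilinearNr x y : op x (- y) = - op x y.
Proof. exact: (bare_linearN (bil.2 x)). Qed.

End BareBilinear.

Lemma add_bilinear (K : fieldType) (U : lmodType K) (op op' : U -> U -> U) :
  bilinear_op op -> bilinear_op op' ->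
  bilinear_op (fun x y => op x y + op' x y).
Proof.
by move=> [ll lr] [l'l l'r]; split=> x a y z;
   rewrite ?(ll, lr) ?(l'l, l'r) scalerDr addrACA.
Qed.

(** * Embedding a dendriform trialgebra into a Rota-Baxter algebra *)

Lemma dend_star_bilinear (K : fieldType) (D : dendTriType K) :
  bilinear_op (tri_star (@tprec K D) tsucc tdot).
Proof.
apply: add_bilinear (@tdot_bilinear K D).
exact: add_bilinear (@tprec_bilinear K D) (@tsucc_bilinear K D).
Qed.

(** This is the sum of the seven axioms of a trialgebra. *)
Lemma dend_starA (K : fieldType) (D : dendTriType K) :
  associative (tri_star (@tprec K D) tsucc tdot).
Proof.
have pbil := @tprec_bilinear K D; have sbil := @tsucc_bilinear K D.
have dbil := @tdot_bilinear K D.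
have starE (x y : D) : tri_star tprec tsucc tdot x y =
  tprec x y + tsucc x y + tdot x y by [].
move=> x y z; rewrite (starE x (_ y z)) (starE (_ x y) z).
rewrite -tprec_prec tsucc_star !starE.
rewrite !(bilinearDl pbil, bilinearDr sbil, bilinearDl dbil, bilinearDr dbil).
rewrite tprec_succ tprec_dot tdot_succ tdot_prec tdot_dot !addrA.
congr (_ + _); rewrite [RHS]addrAC; congr (_ + _).
by rewrite addrAC; congr (_ + _); rewrite addrAC.
Qed.

(** The carrier [D * D] under another name, so that the products below are
    attached to it and not to every pair of modules. *)
Definition dend_double (K : fieldType) (D : dendTriType K) : Type :=
  (D * D)%type.

Section DendDouble.
Variables (K : fieldType) (D : dendTriType K).

HB.instance Definition _ := GRing.Lmodule.on (dend_double D).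

Local Notation star := (tri_star (@tprec K D) tsucc tdot).

Definition double_mul (x y : dend_double D) : dend_double D :=
  (star x.1 y.1, tsucc x.1 y.2 + tprec x.2 y.1 + tdot x.2 y.2).

Definition double_rb (x : dend_double D) : dend_double D := (x.2 - x.1, 0).

Fact double_mul_bilinear : bilinear_op double_mul.
Proof.
have [tl tr] := @dend_star_bilinear K D.
have [pl pr] := @tprec_bilinear K D; have [sl sr] := @tsucc_bilinear K D.
have [dl dr] := @tdot_bilinear K D.
split=> [y a x z|x a y z]; congr pair; rewrite /= ?(tl, tr) //.
  by rewrite pl sl dl !scalerDr [RHS]addrACA; congr (_ + _); rewrite addrACA.
by rewrite pr sr dr !scalerDr [RHS]addrACA; congr (_ + _); rewrite addrACA.
Qed.

(** In the second component every mixed product is moved by one of the seven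
    axioms; the first component is [dend_starA]. *)
Fact double_mulA : associative double_mul.
Proof.
have pbil := @tprec_bilinear K D; have sbil := @tsucc_bilinear K D.
have dbil := @tdot_bilinear K D.
move=> x y z; rewrite /double_mul /=; congr pair; first exact: dend_starA.
rewrite !(bilinearDl pbil, bilinearDr sbil, bilinearDl dbil, bilinearDr dbil).
rewrite tsucc_star tprec_succ tprec_prec tprec_dot.
rewrite tdot_succ tdot_prec tdot_dot !addrA; congr (_ + _).
rewrite addrAC; congr (_ + _).
by rewrite (addrAC _ (tsucc _ (tdot _ _))) addrAC.
Qed.

HB.instance Definition _ :=
  isNonunitaryAlgebra.Build K (dend_double D) double_mul_bilinear double_mulA.

Fact double_rb_linear : linear double_rb.
Proof.
move=> a x y; congr pair; rewrite /= ?scaler0 ?addr0 //.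
by rewrite scalerBr opprD addrACA.
Qed.

(** With [x = (a, b)] and [y = (c, d)] both sides lie in the first summand:
    the left one is [star (b - a) (d - c)], and the argument of the operator on
    the right has second component [star b d], where the terms in [a] and [c]
    cancel, and first component [star b c - star a c + star a d]. *)
Fact double_rbM (x y : dend_double D) :
  nmul (double_rb x) (double_rb y) =
  double_rb (nmul (double_rb x) y + nmul x (double_rb y) + nmul x y).
Proof.
have tbil := @dend_star_bilinear K D.
have pbil := @tprec_bilinear K D; have sbil := @tsucc_bilinear K D.
have dbil := @tdot_bilinear K D.
case: x y => [a b] [c d]; rewrite /nmul /= /double_mul /double_rb /=.
rewrite !(bilinear0l pbil, bilinear0r sbil, bilinear0l dbil, bilinear0r dbil).
rewrite !(addr0, add0r); congr pair.
have -> : tsucc (b - a) d + tprec b (d - c) +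
    (tsucc a d + tprec b c + tdot b d) = star b d.
  by rewrite addrA addrACA -(bilinearDl sbil) -(bilinearDr pbil) !subrK
     (addrC (tsucc _ _)).
rewrite -[X in _ = _ - X]addrA -(bilinearDr tbil) subrK.
rewrite (bilinearDr tbil) (bilinearDl tbil b).
rewrite !(bilinearNl tbil, bilinearNr tbil).
by rewrite [X in _ = _ + X]opprD addrAC [RHS]addrA.
Qed.

HB.instance Definition _ :=
  hasRotaBaxterOperator.Build K (dend_double D) double_rb_linear double_rbM.

Definition dend_embed (x : D) : rb_dend (dend_double D) := (0, x).

Lemma dend_embed_inj : injective dend_embed.
Proof. by move=> x y []. Qed.

Lemma dend_embed_morphism : is_dend_morphism dend_embed.
Proof.
have tbil := @dend_star_bilinear K D.
have pbil := @tprec_bilinear K D; have sbil := @tsucc_bilinear K D.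
have dbil := @tdot_bilinear K D.
split=> [a x y|x y|x y|x y]; congr pair;
  rewrite /= ?subr0 ?scaler0 ?addr0 ?(bilinear0l tbil, bilinear0r tbil) //;
  by rewrite ?(bilinear0l sbil, bilinear0r sbil, bilinear0l pbil,
               bilinear0r pbil, bilinear0l dbil, bilinear0r dbil)
             ?(add0r, addr0).
Qed.

End DendDouble.

(** * The tensor algebra is the free nonunitary algebra *)

Section Products.
Variables (K : fieldType) (A : nuAlgType K).
Implicit Types (x : A) (s : seq A).

(** There is no unit to serve as the empty product, so [0] is a mere default
    there and the identities below ask for nonempty sequences. *)
Fixpoint nuprod s : A :=
  if s is x :: s' then (if s' is [::] then x else nmul x (nuprod s')) else 0.

Lemma nuprod_cons x s : s != [::] -> nuprod (x :: s) = nmul x (nuprod s).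
Proof. by case: s. Qed.

Lemma nuprod_cat s t :
  s != [::] -> t != [::] -> nuprod (s ++ t) = nmul (nuprod s) (nuprod t).
Proof.
move=> + t0; elim: s => // x [|y s] IHs _; first exact: nuprod_cons.
by rewrite cat_cons nuprod_cons // IHs // nmulA -nuprod_cons.
Qed.

Lemma nuprod_linear s t : linear (fun x => nuprod (s ++ x :: t)).
Proof.
have [ml mr] := @nmul_bilinear K A.
elim: s => [|y s IHs] a x z.
  case: t => [|w t] //; have t0 : w :: t != [::] by [].
  by rewrite !cat0s !(nuprod_cons _ t0) ml.
have cat0 w : s ++ w :: t != [::] by case: s {IHs}.
by rewrite !cat_cons !(nuprod_cons _ (cat0 _)) IHs mr.
Qed.

(** Hence the product of the images under [f] factors through the tensor
    power. *)
Lemma nuprod_multilinear (V : lmodType K) (f : V -> A) n : linear f ->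
  is_multilinear (fun u : n.-tuple V => nuprod (map f u)).
Proof.
move=> lf u k; set s := map f (take k u); set t := map f (drop k.+1 u).
have prodE v : nuprod (map f [tuple if j == k then v else tnth u j | j < n]) =
    nuprod (s ++ f v :: t).
  congr nuprod; rewrite -map_cons -map_cat; congr map.
  have szk : size (take k u) = k by apply: size_takel; rewrite size_tuple ltnW.
  apply: (@eq_from_nth _ v) => [|j].
    rewrite size_cat /= szk size_drop !size_tuple card_ord.
    by rewrite subnSK // subnKC // ltnW.
  rewrite size_tuple => ltjn.
  rewrite -(tnth_nth v _ (Ordinal ltjn)) tnth_mktuple nth_cat szk -val_eqE /=.
  rewrite (tnth_nth v) /=.
  case: ltngtP => [ltjk|ltkj|->]; first by rewrite nth_take.
    by rewrite -(subnSK ltkj) /= nth_drop subnKC.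
  by rewrite subnn.
move=> a x y; rewrite !prodE lf; exact: nuprod_linear.
Qed.

End Products.

Section TensorAlgebra.
Variables (K : fieldType) (V : lmodType K) (P : nat -> lmodType K).
Variables (tau : forall n : nat, n.+1.-tuple V -> P n).
Variables (B : nuAlgType K) (inj : forall n : nat, P n -> B).
Hypothesis tensorB : is_nonunitary_tensor_algebra tau inj.

(** Pure tensors span the tensor algebra: a linear map on it is determined by
    its values on them, by uniqueness in the universal property of each tensor
    power and then of the direct sum. *)
Lemma tensor_algebra_ext (W : lmodType K) (g h : B -> W) :
  linear g -> linear h ->
  (forall n u, g (inj (tau u)) = h (inj (@tau n u))) -> g =1 h.
Proof.
have [tensorP [linj sumP] _] := tensorB; move=> lg lh gh.
have ghP n : g \o @inj n =1 h \o @inj n.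
  have [mtau univ] := tensorP n.
  have lgi : linear (g \o @inj n) by exact: comp_linear.
  have lhi : linear (h \o @inj n) by exact: comp_linear.
  have mgt : is_multilinear (g \o @inj n \o @tau n).
    by move=> u k; apply: comp_linear lgi (mtau u k).
  have [g' [_ _ uniq]] := univ W _ mgt.
  by move=> p; rewrite (uniq _ lgi) // (uniq _ lhi) // => u; rewrite /= gh.
have [g' [_ _ uniq]] := sumP W _ (fun n => comp_linear lg (linj n)).
by move=> b; rewrite (uniq g) // (uniq h) // => n p; rewrite -ghP.
Qed.

Lemma tensor_incl_linear : linear (tensor_incl tau inj).
Proof.
have [tensorP [linj _] _] := tensorB; have [mtau _] := tensorP 0%N.
apply: comp_linear (linj 0%N) _ => a x y.
have incl1 v :
    [tuple if k == ord0 then v else tnth [tuple 0] k | k < 1] = [tuple v].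
  by apply: eq_from_tnth => k; rewrite tnth_mktuple ord1 /= tnth0.
by have := mtau [tuple 0] ord0 a x y; rewrite !incl1.
Qed.

(** The extension sends a pure tensor to the product of the images of its
    factors; it is multiplicative because concatenation of tensors goes to the
    product, which is checked on pure tensors one variable at a time. *)
Lemma tensor_algebra_extension (A : nuAlgType K) (f : V -> A) : linear f ->
  exists F : B -> A, is_nualg_morphism F /\ F \o tensor_incl tau inj =1 f.
Proof.
have [tensorP [linj sumP] injM] := tensorB => lf.
have deg n : exists g : P n -> A,
    linear g /\ forall u, g (tau u) = nuprod (map f u).
  have [_ univ] := tensorP n.
  have [g [lg g_tau _]] := univ A _ (@nuprod_multilinear _ A V f n.+1 lf).
  by exists g; split=> // u; exact: g_tau.
(* The direct sum asks for the maps in all degrees as one function; choice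
   extracts it from their existence in each degree. *)
pose g n := proj1_sig (constructive_indefinite_description _ (deg n)).
have gP n : linear (g n) /\ forall u, g n (tau u) = nuprod (map f u).
  exact: proj2_sig (constructive_indefinite_description _ (deg n)).
have [F [lF F_inj _]] := sumP A g (fun n => (gP n).1).
have F_prod n u : F (inj (@tau n u)) = nuprod (map f u).
  by rewrite -(gP n).2; exact: F_inj.
exists F; split; last by move=> v; rewrite /= F_prod.
have [ml mr] := @nmul_bilinear K A; have [bl br] := @nmul_bilinear K B.
have lFl x : linear (fun y => F (nmul x y)) by exact: comp_linear lF (br x).
have lFr y : linear (fun x => F (nmul x y)) by exact: comp_linear lF (bl y).
have lMl x : linear (fun y => nmul (F x) (F y)).
  exact: comp_linear (mr (F x)) lF.
have lMr y : linear (fun x => nmul (F x) (F y)).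
  exact: comp_linear (ml (F y)) lF.
have map0 n (u : n.+1.-tuple V) : map f u != [::].
  by rewrite -size_eq0 size_map size_tuple.
split=> // x y; move: x; apply: tensor_algebra_ext => // m u.
move: y; apply: tensor_algebra_ext => // n v.
by rewrite injM !F_prod map_cat nuprod_cat.
Qed.

End TensorAlgebra.

(** * The free trialgebra inside the free Rota-Baxter algebra *)

Lemma rb_dend_morphism (K : fieldType) (A B : rbAlgType K) (g : A -> B) :
  is_rb_morphism g -> is_dend_morphism (g : rb_dend A -> rb_dend B).
Proof.
move=> [[lg gM] gR]; split=> // x y.
- by rewrite /tprec /= /rb_prec gM gR.
by rewrite /tsucc /= /rb_succ gM gR.
Qed.

Lemma comp_dend_morphism (K : fieldType) (S T U : dendTriType K)
    (g : T -> U) (f : S -> T) :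
  is_dend_morphism g -> is_dend_morphism f -> is_dend_morphism (g \o f).
Proof.
move=> [lg gp gs gd] [lf fp fs fd]; split; first exact: comp_linear.
- by move=> x y; rewrite /= fp gp.
- by move=> x y; rewrite /= fs gs.
by move=> x y; rewrite /= fd gd.
Qed.

Theorem theorem4p5 (K : fieldType) (V : lmodType K)
    (P : nat -> lmodType K) (tau : forall n : nat, n.+1.-tuple V -> P n)
    (TV : nuAlgType K) (inj : forall n : nat, P n -> TV)
    (TVP : is_nonunitary_tensor_algebra tau inj)
    (Sha : rbAlgType K) (j : TV -> Sha) (ShaP : is_free_rb j)
    (D : dendTriType K) (i : V -> D) (DP : is_free_dend i) :
  exists phi : D -> rb_dend Sha,
    [/\ is_dend_morphism phi,
        phi \o i =1 j \o tensor_incl tau inj,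
        (forall psi : D -> rb_dend Sha, is_dend_morphism psi ->
           psi \o i =1 j \o tensor_incl tau inj -> psi =1 phi)
      & injective phi].
Proof.
have [[[lj _] Sha_univ] [li D_univ]] := (ShaP, DP).
have lincl : linear (j \o tensor_incl tau inj : V -> rb_dend Sha).
  exact: comp_linear lj (tensor_incl_linear TVP).
have [phi [phiM phi_i phi_uniq]] := D_univ _ _ lincl.
exists phi; split=> //.
have eM := dend_embed_morphism D; have [le _ _ _] := eM.
have lei : linear (@dend_embed K D \o i) by exact: comp_linear.
have [F [FM F_incl]] :=
  tensor_algebra_extension TVP (lei : linear (_ : V -> dend_double D)).
have [G [GM G_j _]] := Sha_univ _ _ FM.
have [h [_ _ h_uniq]] := D_univ _ _ lei.
have Gphi : G \o phi =1 @dend_embed K D.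
  move=> x; rewrite (h_uniq (@dend_embed K D)) //; apply: h_uniq.
    exact: comp_dend_morphism (rb_dend_morphism GM) phiM.
  by move=> v; rewrite /= [phi _]phi_i; apply: etrans (G_j _) (F_incl v).
apply: (@inj_compr _ _ _ G); apply: eq_inj (@dend_embed_inj K D) _ => x.
exact: esym (Gphi x).
Qed.
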